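(* Let $K$ be any compact metric space. Then for every $\mu \in B_{C(K)^*}$, where $C(K)$ is the Banach space of real continuous functions on $K$, there are sequences $(x_n)_{n \ge 1}$ in $K$ and $(\varepsilon_n)_{n \ge 1}$ in $\{\pm 1\}$ such that $$\frac{\varepsilon_1 \delta_{x_1} + \dots + \varepsilon_N \delta_{x_N}}{N} \longrightarrow \mu \quad \text{in the weak}^* \text{ topology of } C(K)^* \text{ as } N \to \infty.$$ If instead $C(K)$ is the Banach space of complex continuous functions on $K$, the same conclusion holds for every $\mu \in B_{C(K)^*}$ with $(\varepsilon_n)$ a sequence in $\mathbb{T} = \{z \in \mathbb{C} : |z| = 1\}$.
   Context: $C(K)$ carries the sup-norm, and $B_{C(K)^*}$ is the closed unit ball of its dual. $\delta_x$ is the Dirac measure (point evaluation) at $x$. *)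

(* Defs.v *)
From HB Require Import structures.
From mathcomp Require Import all_boot all_order all_algebra.
From mathcomp Require Import boolp classical_sets functions reals topology.
From mathcomp Require Import normedtype complex.

Set Implicit Arguments.
Unset Strict Implicit.
Unset Printing Implicit Defensive.

Import Order.TTheory GRing.Theory Num.Theory.
Import numFieldNormedType.Exports.

Local Open Scope classical_set_scope.
Local Open Scope ring_scope.

(* The norm of a normed module over [F] is [F]-valued, so sup-norms over the
   complex field require suprema, in [F], of sets of nonnegative reals. *)
HB.mixin Record NumField_hasSup F & Num.NumField F := {
  num_supremums : forall A : set F,
    A `<=` [set z | 0 <= z] -> has_sup A -> supremums A !=set0 }.

#[short(type="supNumFieldType")]
HB.structure Definition SupNumField :=
  { F of Num.NumField F & NumField_hasSup F }.

Lemma real_supremums (R : realType) (A : set R) :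
  A `<=` [set z | 0 <= z] -> has_sup A -> supremums A !=set0.
Proof.
move=> _ supA; exists (sup A); split; first exact: sup_upper_bound.
by move=> b bA; apply: ge_sup => //; case: supA.
Qed.

#[non_forgetful_inheritance]
HB.instance Definition _ (R : realType) :=
  NumField_hasSup.Build R (@real_supremums R).

Lemma complex_supremums (R : realType) (A : set R[i]) :
  A `<=` [set z | 0 <= z] -> has_sup A -> supremums A !=set0.
Proof.
move=> A0 [[a Aa] [b bA]].
have ge0E (z : R[i]) : 0 <= z -> z = (complex.Re z)%:C%C.
  by case: z => x y; rewrite lecE /= => /andP[/eqP-> _].
have AE z : A z -> z = (complex.Re z)%:C%C by move/A0/ge0E.
have ubE c : ubound A c -> c = (complex.Re c)%:C%C.
  by move=> cA; apply: ge0E; exact: le_trans (A0 _ Aa) (cA _ Aa).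
have ReA : has_sup (@complex.Re R @` A).
  split; first by exists (complex.Re a), a.
  exists (complex.Re b) => _ [z Az <-].
  by have := bA z Az; rewrite {1}(AE _ Az) {1}(ubE _ bA) lecR.
exists (sup (@complex.Re R @` A))%:C%C; split=> [z Az|c cA].
  rewrite (AE _ Az) lecR; apply: sup_upper_bound => //; by exists z.
rewrite (ubE _ cA) lecR; apply: ge_sup; first by case: ReA.
by move=> _ [z Az <-]; have := cA z Az; rewrite {1}(AE _ Az) {1}(ubE _ cA) lecR.
Qed.

HB.instance Definition _ (R : realType) :=
  NumField_hasSup.Build R[i] (@complex_supremums R).

Lemma supremumsP (F : supNumFieldType) (A : set F) :
  A `<=` [set z | 0 <= z] -> has_sup A -> supremums A (supremum 0 A).
Proof.
move=> A0 supA; have [s As] := num_supremums _ A0 supA.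
rewrite /supremum ifF; last by apply/negbTE/set0P; case: supA.
by case: xgetP => [_ _ //|/(_ s)].
Qed.

(* [C Kc F] is C(K), the space of continuous functions K -> F; the proof [Kc]
   that K is compact is a parameter because the sup-norm depends on it. *)
Definition C (K : topologicalType) (Kc : compact [set: K])
  (F : numFieldType) : Type := continuousType K F^o.

Section C_lmodType.
Context (K : topologicalType) (Kc : compact [set: K]) (F : numFieldType).
Local Notation CK := (C Kc F).

HB.instance Definition _ := Choice.on CK.

Lemma C_ext (f g : CK) : (forall x, f x = g x) -> f = g.
Proof. by move=> fg; apply/continuousEP. Qed.

Definition C_zero : CK := cst (0 : F^o).

Let opp_cts (f : CK) : continuous (\- f : K -> F^o).
Proof. by move=> x; apply: cvgN; exact: cts_fun. Qed.
Definition C_opp (f : CK) : CK := mkcts (@opp_cts f).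

Let add_cts (f g : CK) : continuous (f \+ g : K -> F^o).
Proof. by move=> x; apply: cvgD; exact: cts_fun. Qed.
Definition C_add (f g : CK) : CK := mkcts (@add_cts f g).

Let scale_cts (a : F) (f : CK) : continuous (fun x => a *: f x : F^o).
Proof. by move=> x; apply: cvgZr; exact: cts_fun. Qed.
Definition C_scale (a : F) (f : CK) : CK := mkcts (@scale_cts a f).

Let addA : associative C_add.
Proof. by move=> f g h; apply: C_ext => x; exact: addrA. Qed.
Let addC : commutative C_add.
Proof. by move=> f g; apply: C_ext => x; exact: addrC. Qed.
Let add0 : left_id C_zero C_add.
Proof. by move=> f; apply: C_ext => x; exact: add0r. Qed.
Let addN : left_inverse C_zero C_opp C_add.
Proof. by move=> f; apply: C_ext => x; exact: addNr. Qed.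

HB.instance Definition _ := GRing.isZmodule.Build CK addA addC add0 addN.

Let scaleA a b (f : CK) : C_scale a (C_scale b f) = C_scale (a * b) f.
Proof. by apply: C_ext => x; exact: scalerA. Qed.
Let scale1 : left_id 1 C_scale.
Proof. by move=> f; apply: C_ext => x; exact: scale1r. Qed.
Let scaleDr : right_distributive C_scale +%R.
Proof. by move=> a f g; apply: C_ext => x; exact: scalerDr. Qed.
Let scaleDl (f : CK) : {morph C_scale^~ f : a b / a + b}.
Proof. by move=> a b; apply: C_ext => x; exact: scalerDl. Qed.

HB.instance Definition _ :=
  GRing.Zmodule_isLmodule.Build F CK scaleA scale1 scaleDr scaleDl.

End C_lmodType.

Section C_normedModType.
Context (K : topologicalType) (Kc : compact [set: K]) (F : supNumFieldType).
Local Notation CK := (C Kc F).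

Definition sup_norm (f : CK) : F := supremum 0 (range (fun x => `|f x|)).

Lemma C_bounded (f : CK) : exists M : F, forall x, `|f x| <= M.
Proof.
have /compact_near_coveringP cK := Kc.
have [|M [_ Mf]] := cK F +oo (fun M x => `|f x| <= M) _; last first.
  by exists (M + 1) => x; apply: Mf => //; rewrite ltrDl.
move=> x _.
have /cvgrPdist_lt/(_ 1 ltr01) fx : f y @[y --> x] --> f x by exact: cts_fun.
near=> y M => /=.
rewrite -[f y](subrK (f x)) (le_trans (ler_normD _ _))// -lerBrDr.
rewrite distrC (@le_trans _ _ 1)//; first by apply: ltW; near: y.
by rewrite lerBrDr addrC; near: M; apply: nbhs_pinfty_ge; rewrite realD ?normr_real ?real1.
Unshelve. all: by end_near. Qed.

Lemma sup_normP (f : CK) (x0 : K) :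
  supremums (range (fun x => `|f x|)) (sup_norm f).
Proof.
apply: supremumsP => [_ [x _ <-]|]; first exact: normr_ge0.
have [M fM] := C_bounded f; split; first by exists `|f x0|, x0.
by exists M => _ [x _ <-].
Qed.

Lemma sup_norm_ub (f : CK) x : `|f x| <= sup_norm f.
Proof. by have [+ _] := sup_normP f x; apply; exists x. Qed.

Lemma sup_norm_le (f : CK) M :
  0 <= M -> (forall x, `|f x| <= M) -> sup_norm f <= M.
Proof.
move=> M0 fM; have [[x0 _]|K0] := pselect (exists x : K, True).
  by have [_] := sup_normP f x0; apply=> _ [x _ <-].
rewrite /sup_norm supremum_out// => -[[_ [x _ _]] _].
by apply: K0; exists x.
Qed.

Lemma sup_norm_ge0 (f : CK) : 0 <= sup_norm f.
Proof.
have [[x0 _]|K0] := pselect (exists x : K, True).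
  exact: le_trans (sup_norm_ub f x0).
rewrite /sup_norm supremum_out// => -[[_ [x _ _]] _].
by apply: K0; exists x.
Qed.

Let sup_normD (f g : CK) : sup_norm (f + g) <= sup_norm f + sup_norm g.
Proof.
apply: sup_norm_le => [|x]; first by rewrite addr_ge0 ?sup_norm_ge0.
by rewrite (le_trans (ler_normD _ _))// lerD ?sup_norm_ub.
Qed.

Let sup_normZ_le (a : F) (f : CK) : sup_norm (a *: f) <= `|a| * sup_norm f.
Proof.
apply: sup_norm_le => [|x]; first by rewrite mulr_ge0 ?sup_norm_ge0.
by rewrite normrM ler_wpM2l ?sup_norm_ub.
Qed.

Let sup_normZ (a : F) (f : CK) : sup_norm (a *: f) = `|a| * sup_norm f.
Proof.
apply/eqP; rewrite eq_le sup_normZ_le/=.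
have [->|a0] := eqVneq a 0; first by rewrite normr0 mul0r sup_norm_ge0.
rewrite -ler_pdivlMl ?normr_gt0// -normfV.
by rewrite -{1}[f](scalerK a0) sup_normZ_le.
Qed.

Let sup_norm0_eq0 (f : CK) : sup_norm f = 0 -> f = 0.
Proof.
move=> f0; apply: C_ext => x; apply/eqP.
by rewrite -normr_le0 -f0 sup_norm_ub.
Qed.

HB.instance Definition _ :=
  Lmodule_isNormed.Build F CK sup_normD sup_normZ sup_norm0_eq0.

End C_normedModType.

Section dual.
Context (F : numFieldType) (V : normedModType F).

Definition continuous_linear : {pred V -> F^o} :=
  fun mu => `[< linear mu /\ continuous mu >].

Fact continuous_linear_submod_closed : submod_closed continuous_linear.
Proof.
split.
  apply/asboolP; split; last by move=> f; exact: cvg_cst.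
  by move=> a f g /=; rewrite scaler0 addr0.
move=> a mu nu /asboolP[mul muc] /asboolP[nul nuc]; apply/asboolP; split.
  move=> b f g; rewrite !fctE mul nul !scalerDr !scalerA.
  by rewrite [b * a]mulrC addrACA.
by move=> f; apply: cvgD; [apply: cvgZr; exact: muc|exact: nuc].
Qed.

HB.instance Definition _ := GRing.isSubmodClosed.Build F (V -> F^o)
  continuous_linear continuous_linear_submod_closed.

Record dual : Type := Dual {
  dual_fun :> V -> F^o;
  _ : dual_fun \in continuous_linear }.

HB.instance Definition _ := [isSub for dual_fun].
HB.instance Definition _ := [Choice of dual by <:].
HB.instance Definition _ := [SubChoice_isSubLmodule of dual by <:].

(* The product topology on [V -> F] is that of pointwise convergence. *)
Definition weak_star : Type :=
  initial_topology (dual_fun : dual -> prod_topology (fun _ : V => F^o)).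

HB.instance Definition _ := Topological.on weak_star.

Definition dual_norm (mu : dual) : F :=
  supremum 0 [set `|mu f| | f in [set f : V | `|f| <= 1]].

End dual.

Lemma dual_normP (F : supNumFieldType) (V : normedModType F) (mu : dual V) :
  supremums [set `|mu f| | f in [set f : V | `|f| <= 1]] (dual_norm mu).
Proof.
apply: supremumsP => [_ [f _ <-]|]; first exact: normr_ge0.
split; first by exists `|mu 0|, 0 => //=; rewrite normr0 ler01.
have /asboolP[mul muc] : dual_fun mu \in @continuous_linear F V.
  by case: (mu).
pose m : {linear V -> F^o} :=
  HB.pack (dual_fun mu) (GRing.isLinear.Build _ _ _ _ _ mul).
have /linear_boundedP/pinfty_ex_gt0[M M0 mM] : bounded_near m (nbhs 0).
  exact/linear_bounded_continuous.
exists M => _ [f /= f1 <-]; apply: le_trans (mM f) _.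
by rewrite ler_piMr // ltW.
Qed.

Section evaluation.
Context (K : topologicalType) (Kc : compact [set: K]) (F : supNumFieldType).

Fact evaluation_subproof (x : K) :
  (fun f : C Kc F => f x) \in @continuous_linear F (C Kc F).
Proof.
apply/asboolP; split=> // f; apply/(@cvgrPdist_lt _ _ _ (nbhs f)) => e e0.
near=> g; apply: le_lt_trans (sup_norm_ub (f - g) x) _.
rewrite -[sup_norm _]/(`|f - g|); near: g; exact: cvgr_dist_lt.
Unshelve. all: by end_near. Qed.

Definition dirac (x : K) : dual (C Kc F) := Dual (evaluation_subproof x).

End evaluation.

(* Main.v *)
From HB Require Import structures.
Require Import Defs.
From mathcomp Require Import all_boot all_order all_algebra.
From mathcomp Require Import boolp classical_sets functions reals topology.
From mathcomp Require Import normedtype complex interval_inference ring lra.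
Import Order.TTheory GRing.Theory Num.Theory.
Import numFieldNormedType.Exports.
Local Open Scope classical_set_scope.
Local Open Scope ring_scope.
Set Implicit Arguments.
Unset Strict Implicit.
Unset Printing Implicit Defensive.

(** The sequence is built greedily.  Let [v k] be functions with norm at most
    [2^-k] that generate a dense subspace of C(K), and let
    [rho_N = sum_(n <= N) eps_n delta_(x_n) - N mu].  It suffices that
    [rho_N (v k) / N] tends to 0 for every k, because the averages and mu all
    lie in the unit ball of the dual ([cvg_of_total]).

    This is controlled by the energy [sum_(k < N) |rho_N (v k)|^2], the square
    of a Hilbertian seminorm of [rho_N].  Replacing a functional rho by
    [rho + nu], where [nu = eps delta_x - mu], changes its energy by the energy
    of nu, which is bounded, and by the cross term [2 Re (nu h)], where
    [h = sum_k conj(rho (v k)) v k] is a function in C(K).  Now take x where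
    |h| nearly attains its maximum and eps such that [eps h(x) = - |h(x)|];
    as [|mu h| <= |h|], the cross term is then at most a constant
    ([greedy_step]).  So the energy grows at most linearly in N
    ([greedy_sequence]), while dividing [rho_N] by N divides it by N^2.

    A sequence generating a dense subspace comes from partitions of unity
    subordinate to finite coverings by balls of radius 1/(n+1), n = 0, 1, ...
    ([C_countable_total]).

    The real and the complex case are treated at once, over a field F with a
    conjugation and an isometric embedding of R onto the real line of F. *)

(** * Weak* convergence *)

Lemma cvg_initial (S : choiceType) (T : topologicalType) (f : S -> T)
    (G : set_system S) (s : S) :
  Filter G -> f @ G --> f s -> G --> (s : initial_topology f).
Proof.
move=> FG fG A [_ [[B oB <-] Bfs] BA]; apply: filterS BA _.
by apply: fG; exact: open_nbhs_nbhs.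
Qed.

Section dual_space.
Context (F : numFieldType) (V : normedModType F).
Implicit Types (mu nu : dual V) (f : V).

Lemma dual_linear mu : linear mu.
Proof. by have /asboolP[] := valP mu. Qed.

HB.instance Definition _ mu :=
  GRing.isLinear.Build F V F^o *:%R (dual_fun mu) (dual_linear mu).

Lemma dual_linearB mu f g : mu (f - g) = mu f - mu g.
Proof. exact: linearB. Qed.

Lemma dual_evalD mu nu f : (mu + nu) f = mu f + nu f.
Proof. by []. Qed.

Lemma dual_evalN mu f : (- mu) f = - mu f.
Proof. by []. Qed.

Lemma dual_evalZ a mu f : (a *: mu) f = a * mu f.
Proof. by []. Qed.

Lemma cvg_weak_star (u : nat -> dual V) mu :
  (forall f, (fun n => u n f : F^o) @ \oo --> (mu f : F^o)) ->
  (u : nat -> weak_star V) @ \oo --> (mu : weak_star V).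
Proof.
move=> umu; apply: cvg_initial; apply/cvg_sup => f.
exact: (@cvg_initial _ F^o (fun g : forall _ : V, F^o => g f)) (umu f).
Qed.

End dual_space.

Lemma dual_bound (F : supNumFieldType) (V : normedModType F) (mu : dual V) f :
  dual_norm mu <= 1 -> `|mu f| <= `|f|.
Proof.
move=> mu1; have [->|f0] := eqVneq f 0.
  by rewrite linear0 !normr0.
have [+ _] := dual_normP mu => /(_ `|mu (`|f|^-1 *: f)|) muub.
have nf0 : 0 < `|f| by rewrite normr_gt0.
rewrite -[leRHS]mulr1 -ler_pdivrMl//.
apply: le_trans mu1; apply: le_trans (muub _).
  by rewrite linearZ/= normrM ger0_norm// invr_ge0.
exists (`|f|^-1 *: f) => //=.
by rewrite normrZ ger0_norm ?invr_ge0// mulVf// gt_eqF.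
Qed.

(** Equivalently, the closed linear span of v is the whole space; the form of an
    induction principle is the one in which this is both proved and used. *)
Definition total (F : numFieldType) (V : normedModType F) (v : nat -> V) :=
  forall P : V -> Prop,
    (forall a f g, P f -> P g -> P (a *: f + g)) ->
    (forall f, (forall e, 0 < e -> exists2 g, P g & `|f - g| <= e) -> P f) ->
    (forall k, P (v k)) -> forall f, P f.

Lemma totalZ (F : numFieldType) (V : normedModType F) (v : nat -> V)
    (a : nat -> F) : (forall k, a k != 0) -> total v ->
  total (fun k => a k *: v k).
Proof.
move=> a0 tv P Plin Pcl Pav; apply: tv => // k.
have P0 : P 0 by rewrite -(addNr (a 0 *: v 0)) -scaleN1r; exact: Plin.
by rewrite -[v k]addr0 -(scalerK (a0 k) (v k)); exact: Plin.
Qed.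

(** The functions on which bounded functionals converge form a closed subspace
    (an epsilon/3 argument). *)
Lemma cvg_of_total (F : supNumFieldType) (V : normedModType F)
    (u : nat -> dual V) (mu : dual V) (v : nat -> V) :
  (forall N f, `|u N f| <= `|f|) -> dual_norm mu <= 1 -> total v ->
  (forall k, (fun N => u N (v k) : F^o) @ \oo --> (mu (v k) : F^o)) ->
  (u : nat -> weak_star V) @ \oo --> (mu : weak_star V).
Proof.
move=> u1 mu1 tv uv; apply: cvg_weak_star; apply: tv => // [a f g uf ug|f fg].
  rewrite linearP; under eq_fun do rewrite linearP.
  by apply: cvgD => //; exact: cvgZr.
apply/cvgrPdist_le => e e0.
have e3 : 0 < e / 3 by rewrite divr_gt0.
have [g /cvgrPdist_le/(_ _ e3) ug fge] := fg _ e3.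
near=> N.
have -> : mu f - u N f = mu (f - g) + (mu g - u N g) - u N (f - g).
  by rewrite !dual_linearB addrA subrK opprB addrA subrK.
have -> : e = e / 3 + e / 3 + e / 3 by field.
apply: le_trans (ler_normB _ _) (lerD (le_trans (ler_normD _ _) (lerD _ _)) _).
- exact: le_trans (dual_bound _ mu1) fge.
- by near: N.
- exact: le_trans (u1 _ _) fge.
Unshelve. all: by end_near. Qed.

Section sup_norm.
Context (K : topologicalType) (Kc : compact [set: K]) (F : supNumFieldType).
Implicit Types (f : C Kc F).

(** If it failed, [|f| - e] would be an upper bound below the supremum.  The
    order of F may be partial, but real elements are comparable. *)
Lemma sup_norm_near_max f (x0 : K) e : 0 < e -> exists x, `|f| - e <= `|f x|.
Proof.
move=> e0; apply: contrapT => /forallNP fe.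
have [_ /(_ (`|f| - e))] := sup_normP f x0.
suff ub : ubound (range (fun x => `|f x|)) (`|f| - e).
  by move=> /(_ ub); rewrite -[sup_norm _]/`|f| lerBrDr gerDl (lt_geF e0).
move=> _ [x _ <-]; apply: ltW.
rewrite real_ltNge ?realB ?normr_real ?gtr0_real//.
exact/negP.
Qed.

Lemma C_evalD f g x : (f + g) x = f x + g x.
Proof. by []. Qed.

Lemma C_evalN f x : (- f) x = - f x.
Proof. by []. Qed.

Lemma C_norm_ub f x : `|f x| <= `|f|.
Proof. exact: sup_norm_ub. Qed.
End sup_norm.

(** * The greedy choice of signed points *)

Section greedy.
Context (K : topologicalType) (Kc : compact [set: K]) (x0 : K).
Context (F : supNumFieldType) (conj : {rmorphism F -> F}).
Hypothesis conjK : involutive conj.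
Hypothesis norm2 : forall z, `|z| ^+ 2 = z * conj z.
Hypothesis add_conj_real : forall z, z + conj z \is Num.real.
(* T is the set of admissible signs: {1, -1} or the unit circle. *)
Context (T : set F).
Hypothesis T1 : forall e, T e -> `|e| = 1.
Hypothesis T_align : forall z, exists2 e, T e & e * z = - `|z|.
Local Notation V := (C Kc F).

Lemma norm_conj z : `|conj z| = `|z|.
Proof. by apply/(@pexpIrn _ 2) => //; rewrite ?nnegrE// !norm2 conjK mulrC. Qed.

(** The last bracket is twice the real part of the inner product. *)
Lemma norm2D (a b : F) :
  `|a + b| ^+ 2 = `|a| ^+ 2 + `|b| ^+ 2 + (conj a * b + conj (conj a * b)).
Proof. by rewrite !norm2 rmorphD rmorphM/= conjK; ring. Qed.

Lemma oppD_conj_le z : - (z + conj z) <= 2 * `|z|.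
Proof.
rewrite mulr_natl mulr2n -[X in _ <= _ + X]norm_conj.
apply: le_trans (ler_normD _ _); rewrite -normrN.
by apply: real_ler_norm; rewrite rpredN.
Qed.

Lemma dirac_bound e x (mu : dual V) f : T e -> dual_norm mu <= 1 ->
  `|(e *: dirac Kc F x - mu) f| <= 2 * `|f|.
Proof.
move=> Te mu1; rewrite dual_evalD dual_evalN dual_evalZ.
apply: le_trans (ler_normB _ _) _.
rewrite normrM T1// mul1r mulr_natl mulr2n lerD//.
  exact: C_norm_ub.
exact: dual_bound.
Qed.

(** The cross terms of the energy of [rho + nu] add up to [2 Re (nu h)], where
    [nu h = - |h x| - mu h].  Since x maximizes |h| up to 1/2 and
    [|mu h| <= |h|], this is at most 1. *)
Lemma greedy_step (mu rho : dual V) (v : nat -> V) m : dual_norm mu <= 1 ->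
  exists x e, T e /\
    \sum_(k < m) `|(rho + (e *: dirac Kc F x - mu)) (v k)| ^+ 2 <=
    \sum_(k < m) `|rho (v k)| ^+ 2 + \sum_(k < m) (2 * `|v k|) ^+ 2 + 1.
Proof.
move=> mu1.
pose h : V := \sum_(k < m) conj (rho (v k)) *: v k.
have [|x hx] := @sup_norm_near_max _ Kc F h x0 2^-1; first by rewrite invr_gt0.
have [e Te ehx] := T_align (h x).
exists x, e; split => //.
set nu : dual V := e *: dirac Kc F x - mu.
have nu_le f : `|nu f| <= 2 * `|f| by exact: dirac_bound.
have nuh : nu h = - `|h x| - mu h.
  by rewrite dual_evalD dual_evalN dual_evalZ ehx.
clearbody nu.
have term_expand k : `|(rho + nu) (v k)| ^+ 2 = `|rho (v k)| ^+ 2 +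
    `|nu (v k)| ^+ 2 +
    (nu (conj (rho (v k)) *: v k) + conj (nu (conj (rho (v k)) *: v k))).
  by rewrite dual_evalD norm2D linearZ.
under eq_bigr do rewrite term_expand.
have nuh_sum : \sum_(k < m) nu (conj (rho (v k)) *: v k) = nu h.
  by rewrite linear_sum.
rewrite !big_split/= -rmorph_sum nuh_sum.
rewrite lerD ?lerD// ?ler_sum// => [k _|].
  by rewrite lerXn2r ?nnegrE ?mulr_ge0// nu_le.
have conj_normr : conj `|h x| = `|h x|.
  have [->|hx0] := eqVneq (h x) 0; first by rewrite normr0 rmorph0.
  by apply: (@mulfI _ `|h x|); rewrite ?normr_eq0// -norm2 normr_id expr2.
rewrite nuh rmorphB rmorphN/= conj_normr addrACA -opprD -!mulr2n -mulr_natl.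
rewrite -opprD addrC lerBlDr (le_trans (oppD_conj_le _))//.
apply: (@le_trans _ _ (2 * `|h|)); first by rewrite ler_wpM2l// dual_bound.
move: hx; rewrite lerBlDr -(@ler_pM2l _ 2)// mulrDr divff ?pnatr_eq0//.
by rewrite addrC.
Qed.

Lemma sum_sqr_dyadic_le (v : nat -> V) m :
  (forall k, `|v k| <= 2^-1 ^+ k) ->
  \sum_(k < m) (2 * `|v k|) ^+ 2 <= 8.
Proof.
move=> vb.
(* The remainder of the geometric series makes the induction go through. *)
suff H : \sum_(k < m) (2 * `|v k|) ^+ 2 <= 8 - 8 * 2^-1 ^+ m.
  by apply: le_trans H _; rewrite gerBl mulr_ge0// exprn_ge0// invr_ge0.
elim: m => [|m IHm]; first by rewrite big_ord0 expr0 mulr1 subrr.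
rewrite big_ord_recr/=; apply: le_trans (lerD IHm (_ : _ <= 4 * 2^-1 ^+ m)) _.
  rewrite exprMn -natrX ler_wpM2l//.
  apply: (@le_trans _ _ (2^-1 ^+ m ^+ 2)).
    by rewrite lerXn2r ?nnegrE// exprn_ge0// invr_ge0.
  by rewrite expr2 ler_piMr ?exprn_ile1 ?exprn_ge0// ?invr_ge0 ?invf_le1 ?ler1n.
by rewrite exprS le_eqVlt; apply/orP; left; apply/eqP; field.
Qed.

(** Energy growth per step: at most 9 on the functions [v k] with k < N, by the
    greedy step, and at most 4 from the function [v N] that enters the sum,
    because [|rho_(N+1) (v N)| <= 2 (N+1) 2^-N <= 2].  Letting the functions
    enter one at a time keeps every h a finite combination. *)
Lemma greedy_sequence (mu : dual V) (v : nat -> V) : dual_norm mu <= 1 ->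
  (forall k, `|v k| <= 2^-1 ^+ k) ->
  exists (x : nat -> K) (eps : nat -> F), (forall n, T (eps n)) /\
    forall N k, (k < N)%N ->
      `|(\sum_(1 <= n < N.+1) eps n *: dirac Kc F (x n) - N%:R *: mu)
          (v k)| ^+ 2 <= 13 * N%:R.
Proof.
move=> mu1 vb.
have /choice[step stepP] : forall p : nat * dual V, exists y : K * F, T y.2 /\
    \sum_(k < p.1) `|(p.2 + (y.2 *: dirac Kc F y.1 - mu)) (v k)| ^+ 2 <=
    \sum_(k < p.1) `|p.2 (v k)| ^+ 2 + 9.
  move=> [m rho]; have [x [e [Te He]]] := greedy_step rho v m mu1.
  exists (x, e); split => //; apply: le_trans He _.
  by rewrite -addrA lerD2l -[9]/(8 + 1)%:R natrD lerD2r sum_sqr_dyadic_le.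
(* The index is shifted because the sums start at n = 1: the step from
   rho_n to rho_(n+1) provides the sign and the point of index n + 1. *)
pose rho := fix rho n := if n is n'.+1 then
  rho n' + ((step (n', rho n')).2 *: dirac Kc F (step (n', rho n')).1 - mu)
  else 0.
exists (fun n => (step (n.-1, rho n.-1)).1),
  (fun n => (step (n.-1, rho n.-1)).2).
split=> [n|N k kN]; first by have [] := stepP (n.-1, rho n.-1).
have <- : rho N = \sum_(1 <= n < N.+1) (step (n.-1, rho n.-1)).2 *:
    dirac Kc F (step (n.-1, rho n.-1)).1 - N%:R *: mu.
  elim: N {kN} => [|N IHN]; first by rewrite big_geq// scale0r subrr.
  rewrite big_nat_recr//= -/rho {1}IHN -[in RHS]natr1 scalerDl scale1r opprD.
  by rewrite addrACA.
have rho_le n f : `|rho n f| <= n%:R * (2 * `|f|).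
  elim: n => [|n IHn]; first by rewrite mul0r normr0.
  rewrite [rho _]/= dual_evalD -natr1 mulrDl mul1r.
  apply: le_trans (ler_normD _ _) (lerD IHn _).
  by apply: dirac_bound => //; have [] := stepP (n, rho n).
have energy : \sum_(k < N) `|rho N (v k)| ^+ 2 <= 13 * N%:R.
  elim: N {kN} => [|N IHN]; first by rewrite big_ord0 mulr0.
  rewrite big_ord_recr.
  have last_le : `|rho N.+1 (v N)| ^+ 2 <= 4.
    rewrite -[4]/(2 ^ 2)%:R natrX lerXn2r ?nnegrE//.
    apply: le_trans (rho_le _ _) _.
    rewrite mulrCA -[leRHS]mulr1 ler_wpM2l//.
    apply: (@le_trans _ _ ((2 ^ N)%:R * 2^-1 ^+ N)).
      by rewrite ler_pM// ler_nat ltn_expl.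
    by rewrite natrX -exprMn mulfV ?expr1n// pnatr_eq0.
  apply: le_trans (lerD _ last_le) _.
    by have [_ +] := stepP (N, rho N); apply.
  by rewrite -addrA -natrD -[N.+1%:R]natr1 mulrDr mulr1 lerD2r; exact: IHN.
apply: le_trans energy; rewrite (bigD1 (Ordinal kN))//= lerDl.
by rewrite sumr_ge0// => i _; rewrite exprn_ge0.
Qed.

Hypothesis arch : forall a : F, 0 <= a -> exists n : nat, a <= n%:R.

(** A square-root bound on [N (b - a N)] leaves [b - a N = O(N^(-1/2))].  The
    threshold N0 is there because [v k] only counts in the energy once N > k. *)
Lemma cvg_of_sq_bound (a : nat -> F) (b c : F) (N0 : nat) : 0 <= c ->
  (forall N, (N0 < N)%N -> `|N%:R * (b - a N)| ^+ 2 <= c * N%:R) ->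
  (a : nat -> F^o) @ \oo --> (b : F^o).
Proof.
move=> c0 ab; apply/cvgrPdist_le => e e0.
have [n cn] := arch (divr_ge0 c0 (exprn_ge0 2 (ltW e0))).
exists (maxn N0.+1 n) => // N /=; rewrite geq_max => /andP[N0N nN].
have N_gt0 : 0 < N%:R :> F by rewrite ltr0n (leq_ltn_trans _ N0N).
rewrite -ler_sqr ?nnegrE ?(ltW e0)//.
rewrite -(@ler_pM2l _ (N%:R ^+ 2)) ?exprn_gt0//.
have := ab N N0N.
rewrite normrM exprMn (ger0_norm (ltW N_gt0)) => /le_trans; apply.
rewrite expr2 mulrAC ler_wpM2r ?(ltW N_gt0)//.
have : c / e ^+ 2 <= N%:R by rewrite (le_trans cn)// ler_nat.
by rewrite ler_pdivrMr// exprn_gt0.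
Qed.

Lemma signed_averages_cvg (mu : dual V) (u : nat -> V) : dual_norm mu <= 1 ->
  (forall k, `|u k| <= 1) -> total u ->
  exists (x : nat -> K) (eps : nat -> F), (forall n, T (eps n)) /\
    (fun N : nat => N%:R^-1 *: \sum_(1 <= n < N.+1) eps n *: dirac Kc F (x n)
      : weak_star V) @ \oo --> (mu : weak_star V).
Proof.
move=> mu1 u1 tu; pose v k := 2^-1 ^+ k *: u k.
have tv : total v.
  by apply: totalZ => // k; rewrite expf_neq0// invr_eq0 pnatr_eq0.
have vb k : `|v k| <= 2^-1 ^+ k.
  rewrite normrZ ger0_norm ?exprn_ge0 ?invr_ge0//.
  by rewrite ler_piMr ?exprn_ge0 ?invr_ge0.
have [x [eps [Teps bd]]] := greedy_sequence mu1 vb.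
exists x, eps; split => //.
pose S N : dual V := \sum_(1 <= n < N.+1) eps n *: dirac Kc F (x n).
have S_le N f : `|S N f| <= N%:R * `|f|.
  rewrite /S; elim: N => [|N IHN]; first by rewrite big_geq// mul0r normr0.
  rewrite big_nat_recr// dual_evalD -natr1 mulrDl mul1r.
  apply: le_trans (ler_normD _ _) (lerD IHN _).
  by rewrite dual_evalZ normrM T1// mul1r; exact: C_norm_ub.
apply: (cvg_of_total (u := fun N => N%:R^-1 *: S N) (v := v)) => // [N f|k].
  rewrite dual_evalZ normrM normfV normr_nat.
  have [->|N0] := posnP N; first by rewrite invr0 mul0r.
  by rewrite ler_pdivrMl ?ltr0n.
apply: (@cvg_of_sq_bound _ _ 13 k) => // N kN.
have := bd N k kN; congr (_ <= _); congr (_ ^+ 2).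
rewrite -normrN dual_evalD dual_evalN !dual_evalZ opprB mulrBr mulrA.
rewrite mulfV ?mul1r//.
by rewrite pnatr_eq0; case: N kN.
Qed.
End greedy.

(** * Partitions of unity on a compact metric space *)

Section partition_of_unity.
Context (R : realType) (K : metricType R) (Kc : compact [set: K]).

(** Compactness in the form of near coverings, along the filter of finite sets
    of points directed by inclusion: a point x is near a net s as soon as x
    itself belongs to s. *)
Lemma totally_bounded (r : R) : 0 < r ->
  exists s : seq K, forall x, exists2 y, y \in s & mdist y x < r.
Proof.
move=> r0; have /compact_near_coveringP cK := Kc.
pose G := filter_from [set: seq K]
  (fun s0 => [set s : seq K | {subset s0 <= s}]).
have FG : Filter G.
  apply: filter_from_filter; first by exists [::].
  move=> s1 s2 _ _; exists (s1 ++ s2) => // s s12.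
  by split=> x xs; apply: s12; rewrite mem_cat xs ?orbT.
have [x _|s _ sK] :=
    cK _ G (fun s x => exists2 y, y \in s & mdist y x < r) FG.
  exists (ball x r, [set s : seq K | {subset [:: x] <= s}]) => /=.
    by split; [exact: nbhsx_ballx|exists [:: x]].
  move=> [y s] /= [xy xs]; exists x; first by apply: xs; rewrite mem_head.
  by rewrite ballEmdist in xy.
by exists s => x; apply: sK.
Qed.

Definition bump (r : R) (y x : K) : R := Num.max 0 (r - mdist y x).

Lemma bump_ge0 r y x : 0 <= bump r y x.
Proof. by rewrite /bump le_max lexx. Qed.

Lemma bump_gt0 r y x : (0 < bump r y x) = (mdist y x < r).
Proof. by rewrite /bump lt_max ltxx subr_gt0. Qed.

Lemma bump_continuous r y : continuous (bump r y).
Proof.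
move=> x; apply/cvgrPdist_lt => e e0.
near=> z.
have xz : mdist x z < e.
  have : ball x e z by near: z; exact: nbhsx_ballx.
  by rewrite ballEmdist.
have := metric_triangle y x z; have := metric_triangle y z x.
rewrite [mdist z x]metric_sym /bump.
by case: (leP 0 (r - mdist y x)); case: (leP 0 (r - mdist y z)) => *;
  rewrite ltr_norml; lra.
Unshelve. all: by end_near. Qed.

Definition hat (r : R) (s : seq K) (y x : K) : R :=
  bump r y x / \sum_(z <- s) bump r z x.

Section net.
Context (r : R) (s : seq K).
Hypothesis net : forall x, exists2 y, y \in s & mdist y x < r.

Lemma sum_bump_gt0 x : 0 < \sum_(z <- s) bump r z x.
Proof.
have [y ys yx] := net x; rewrite (big_rem y)//= ltr_pwDl ?bump_gt0//.
by rewrite sumr_ge0// => z _; exact: bump_ge0.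
Qed.

Lemma hat_ge0 y x : 0 <= hat r s y x.
Proof. by rewrite divr_ge0 ?bump_ge0// ltW// sum_bump_gt0. Qed.

Lemma sum_hat x : \sum_(y <- s) hat r s y x = 1.
Proof. by rewrite -mulr_suml mulfV// gt_eqF// sum_bump_gt0. Qed.

Lemma hat_le1 y x : y \in s -> hat r s y x <= 1.
Proof.
move=> ys; rewrite -(sum_hat x) (big_rem y)//= lerDl sumr_ge0// => z _.
exact: hat_ge0.
Qed.

Lemma hat_eq0 y x : r <= mdist y x -> hat r s y x = 0.
Proof.
move=> ryx; rewrite /hat (_ : bump r y x = 0) ?mul0r//.
by apply/eqP; rewrite eq_le bump_ge0 leNgt bump_gt0 -leNgt ryx.
Qed.

Lemma hat_continuous y : continuous (hat r s y).
Proof.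
move=> x; apply: cvgM; first exact: bump_continuous.
apply: cvgV; first by rewrite gt_eqF// sum_bump_gt0.
by apply: (continuous_big add_continuous) => z _; exact: bump_continuous.
Qed.
End net.
End partition_of_unity.

(** * Separability of C(K) *)

Section countable_total.
Context (R : realType) (K : metricType R) (Kc : compact [set: K]).
Context (F : supNumFieldType) (of_real : {rmorphism R -> F}).
Hypothesis norm_of_real : forall r, `|of_real r| = of_real `|r|.
Hypothesis of_real_onto : forall z : F, 0 <= z -> exists r, z = of_real r.
Local Notation V := (C Kc F).

Lemma of_real_ge0 r : 0 <= r -> 0 <= of_real r.
Proof. by move=> r0; rewrite -(ger0_norm r0) -norm_of_real. Qed.

Lemma ler_of_real : {mono of_real : a b / a <= b}.
Proof.
move=> a b; apply/idP/idP => [|ab]; last first.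
  by rewrite -subr_ge0 -rmorphB of_real_ge0// subr_ge0.
apply: contraTT; rewrite -!ltNge => ba; rewrite lt_geF//.
rewrite lt_neqAle fmorph_eq lt_eqF//= -subr_ge0 -rmorphB of_real_ge0//.
by rewrite subr_ge0 ltW.
Qed.

Lemma of_real_arch (a : F) : 0 <= a -> exists n : nat, a <= n%:R.
Proof.
move=> /of_real_onto[r ->]; exists (Num.truncn r).+1.
by rewrite -(rmorph_nat of_real) ler_of_real ltW// truncnS_gt.
Qed.

Lemma of_real_continuous : continuous (of_real : R -> F^o).
Proof.
move=> r; apply/cvgrPdist_lt => e e0.
have [d ed] := of_real_onto (ltW e0).
have d0 : 0 < d.
  move: e0; rewrite ed -(rmorph0 of_real) !lt_neqAle.
  by rewrite ler_of_real fmorph_eq.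
near=> s; rewrite -rmorphB norm_of_real ed lt_neqAle ler_of_real fmorph_eq.
rewrite -lt_neqAle; near: s; exact: cvgr_dist_lt.
Unshelve. all: by end_near. Qed.

(** The scale is [1/(n+1)] so that it can be matched with the n-th net. *)
Lemma uniformly_continuous (f : V) (e : F) : 0 < e ->
  exists n, forall x y, mdist x y < n.+1%:R^-1 -> `|f x - f y| <= e.
Proof.
move=> e0; have /compact_near_coveringP cK := Kc.
have [x _|n _ fn] := cK nat \oo (fun n x => forall y, mdist x y < n.+1%:R^-1 ->
    `|f x - f y| <= e) _; last by exists n => x y; apply: fn => /=.
have e2 : 0 < e / 2 by rewrite divr_gt0.
have /cvgrPdist_le/(_ _ e2) : f y @[y --> x] --> f x by exact: cts_fun.
move=> /nbhs_ballP[d /= d0 fd].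
have d2 : 0 < d / 2 by rewrite divr_gt0.
near=> z n => y zy /=.
have xz : ball x (d / 2) z by near: z; exact: nbhsx_ballx.
have nd : n.+1%:R^-1 < d / 2.
  by near: n; exact: (near_infty_natSinv_lt (PosNum d2)).
have xy : ball x d y.
  rewrite [d]splitr; apply: ball_triangle xz _.
  by rewrite ballEmdist/= (lt_trans zy).
have xz' : ball x d z by apply: le_ball xz; lra.
have -> : f z - f y = (f x - f y) - (f x - f z).
  by rewrite opprB [RHS]addrC addrA subrK.
by rewrite [e]splitr; apply: le_trans (ler_normB _ _) (lerD _ _); exact: fd.
Unshelve. all: by end_near. Qed.

(** Uniform continuity makes [sum_y f(y) hat_y] close to f, where y runs over a
    fine enough net: at each x this sum is an average of values of f at points
    near x. *)
Lemma C_countable_total (x0 : K) :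
  exists u : nat -> V, (forall k, `|u k| <= 1) /\ total u.
Proof.
have /choice[net netP] : forall n, exists s : seq K, forall x,
    exists2 y, y \in s & mdist y x < n.+1%:R^-1 :> R.
  by move=> n; apply: (totally_bounded Kc); rewrite invr_gt0.
have hat_cts n y :
    continuous (fun x => of_real (hat n.+1%:R^-1 (net n) y x) : F^o).
  move=> x; apply: continuous_comp; last exact: of_real_continuous.
  exact: hat_continuous (netP n) y x.
pose phi n y : V := mkcts (hat_cts n y).
(* An index k codes a radius n and the position i of a point in the net n. *)
pose u k : V := if unpickle k is Some (n, i) then
  if (i < size (net n))%N then phi n (nth x0 (net n) i) else 0 else 0.
exists u; split=> [k|P Plin Pcl Pu f].
  rewrite /u; case: unpickle => [[n i]|]; last by rewrite normr0.
  case: ifPn => [ilt|_]; last by rewrite normr0.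
  apply: sup_norm_le => // x /=.
  rewrite norm_of_real ger0_norm; last exact: hat_ge0 (netP n) _ _.
  rewrite -(rmorph1 of_real) ler_of_real.
  by apply: hat_le1 (netP n) _ _ _; exact: mem_nth.
have Pphi n y : y \in net n -> P (phi n y).
  move=> yn; suff <- : u (pickle (n, index y (net n))) = phi n y by [].
  by rewrite /u pickleK index_mem yn nth_index.
have P0 : P 0 by rewrite -(addNr (u 0)) -scaleN1r; exact: Plin.
apply: Pcl => e e0; have [n fn] := uniformly_continuous f e0.
exists (\sum_(y <- net n) f y *: phi n y).
  rewrite big_seq; elim/big_ind: _ => // [g h Pg Ph|y yn].
    by rewrite -[g]scale1r; exact: Plin.
  by rewrite -[_ *: _]addr0; apply: Plin => //; exact: Pphi.
apply: sup_norm_le; first exact: ltW.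
move=> x; set r := n.+1%:R^-1 : R.
have -> : (f - \sum_(y <- net n) f y *: phi n y) x =
    \sum_(y <- net n) of_real (hat r (net n) y x) * (f x - f y).
  transitivity (f x - \sum_(y <- net n) f y * of_real (hat r (net n) y x)).
    rewrite C_evalD C_evalN; congr (_ - _).
    by elim/big_ind2 : _ => // g a h b <- <-.
  rewrite -[f x in LHS]mul1r -(rmorph1 of_real) -(sum_hat (netP n) x).
  rewrite rmorph_sum mulr_suml -sumrB; apply: eq_bigr => y _.
  by rewrite mulrBr [f y * _]mulrC.
have -> : e = \sum_(y <- net n) of_real (hat r (net n) y x) * e.
  by rewrite -mulr_suml -rmorph_sum (sum_hat (netP n)) rmorph1 mul1r.
apply: le_trans (ler_norm_sum _ _ _) _; apply: ler_sum => y _.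
have [yx|yx] := ltP (mdist y x) r; last first.
  by rewrite (hat_eq0 _ yx) rmorph0 !mul0r normr0.
rewrite normrM norm_of_real (ger0_norm (hat_ge0 (netP n) y x)).
rewrite ler_wpM2l//; last by apply: fn; rewrite metric_sym.
by apply: of_real_ge0; exact: hat_ge0 (netP n) _ _.
Qed.
End countable_total.

(** * The real and the complex case *)

Theorem theorem4 (R : realType) (K : metricType R)
    (Kc : compact [set: K]) (K0 : [set: K] !=set0) :
  (forall mu : dual (C Kc R), dual_norm mu <= 1 ->
    exists (x : nat -> K) (eps : nat -> R),
      (forall n, eps n = 1 \/ eps n = -1) /\
      (fun N : nat => N%:R^-1 *: \sum_(1 <= n < N.+1) eps n *: dirac Kc R (x n)
        : weak_star (C Kc R)) @ \oo --> (mu : weak_star (C Kc R)))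
  /\
  (forall mu : dual (C Kc R[i]), dual_norm mu <= 1 ->
    exists (x : nat -> K) (eps : nat -> R[i]),
      (forall n, `|eps n| = 1) /\
      (fun N : nat => N%:R^-1 *: \sum_(1 <= n < N.+1) eps n *: dirac Kc R[i] (x n)
        : weak_star (C Kc R[i])) @ \oo --> (mu : weak_star (C Kc R[i]))).
Proof.
have [x0 _] := K0; split=> mu mu1.
- have onto (z : R) : 0 <= z -> exists r, z = idfun r by exists z.
  have [u [u1 tu]] := @C_countable_total R K Kc R idfun (fun=> erefl) onto x0.
  apply: (@signed_averages_cvg _ Kc x0 R idfun _ _ _
    [set e | e = 1 \/ e = -1] _ _ _ mu u mu1 u1 tu) => //.
  + by move=> z; rewrite real_normK// num_real.
  + by move=> z; rewrite num_real.
  + by move=> e [->|->]; rewrite ?normrN normr1.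
  + move=> z; have [z0|z0] := leP 0 z.
      by exists (-1); [right|rewrite mulN1r ger0_norm].
    by exists 1; [left|rewrite mul1r ltr0_norm// opprK].
  + exact: (@of_real_arch R R idfun (fun=> erefl) onto).
- have norm_real (r : R) : `|r%:C%C| = `|r|%:C%C :> R[i].
    by rewrite normc_def/= expr0n/= addr0 sqrtr_sqr.
  have onto (z : R[i]) : 0 <= z -> exists r, z = r%:C%C.
    by case: z => a b; rewrite lecE/= => /andP[/eqP-> _]; exists a.
  have [u [u1 tu]] :=
    @C_countable_total R K Kc R[i] (@real_complex R) norm_real onto x0.
  apply: (@signed_averages_cvg _ Kc x0 R[i] (@conjc R) _ _ _
    [set e | `|e| = 1] _ _ _ mu u mu1 u1 tu) => //.
  + exact: conjcK.
  + exact: sqr_normc.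
  + by case=> a b; rewrite complex_real/= subrr.
  + move=> z; have [->|z0] := eqVneq z 0.
      by exists 1; [exact: normr1|rewrite mul1r normr0 oppr0].
    exists (- `|z| / z); last by rewrite divfK.
    by rewrite /= normrM normfV normrN normr_id mulfV ?normr_eq0.
  + exact: (@of_real_arch R R[i] (@real_complex R) norm_real onto).
Qed.
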